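(* Let $n \geq 1$ be a natural number and let $R > 2$ be a real number. If $K \subset \mathbb{E}^n$ is a $1$-separated set of points with diameter at most $R-1$ and $|K| > 10^{4n} \log R$, then $\mathbb{E}^n \not\longrightarrow (\ell_2, K)$; that is, there exists a red/blue-coloring of $\mathbb{E}^n$ which contains no two red points at distance exactly one and no blue isometric copy of $K$.
   Context: $\mathbb{E}^n$ denotes $\mathbb{R}^n$ with the Euclidean distance. A red/blue-coloring of $\mathbb{E}^n$ is an arbitrary assignment of one of the two colors to each point. A copy of a set always means an isometric copy; a copy is red (blue) if all its points are red (blue). $\ell_m$ denotes a sequence of $m$ points on a line with consecutive points at distance one, so $\ell_2$ is a pair of points at distance one. $\mathbb{E}^n \longrightarrow (\ell_2,K)$ means that every red/blue-coloring of $\mathbb{E}^n$ contains a red copy of $\ell_2$ or a blue copy of $K$, and $\mathbb{E}^n \not\longrightarrow (\ell_2,K)$ is its negation. A set $S \subset \mathbb{E}^n$ is $t$-separated if any two distinct points of $S$ have distance at least $t$. $\log$ is the logarithm to base $2$. *)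

(* Defs.v *)
From HB Require Import structures.
From mathcomp Require Import all_boot all_order all_algebra.
From mathcomp Require Import all_classical all_reals all_analysis.
Set Implicit Arguments.
Unset Strict Implicit.
Unset Printing Implicit Defensive.
Import Order.TTheory GRing.Theory Num.Theory.
Local Open Scope classical_set_scope.
Local Open Scope ring_scope.

(* The norm MathComp-Analysis puts on ['rV[R]_n] is the sup norm, so the
   Euclidean distance has to be defined separately. *)
Definition edist (R : realType) (n : nat) (x y : 'rV[R]_n) : R :=
  Num.sqrt (\sum_(i < n) (x 0 i - y 0 i) ^+ 2).

Definition t_separated (R : realType) (n : nat) (t : R) (S : set 'rV[R]_n) :
    Prop :=
  forall x y, S x -> S y -> x <> y -> t <= edist x y.

(* [+oo] for unbounded sets, [-oo] for the empty set *)
Definition diameter (R : realType) (n : nat) (S : set 'rV[R]_n) : \bar R :=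
  ereal_sup [set (edist p.1 p.2)%:E | p in S `*` S].

(* [A] and [B] may live in spaces of different dimensions: the line segment
   configurations [ell m] below are subsets of the one-dimensional space. *)
Definition isometric_copy (R : realType) (m n : nat)
    (A : set 'rV[R]_m) (B : set 'rV[R]_n) : Prop :=
  exists f : 'rV[R]_m -> 'rV[R]_n,
    (forall x y, A x -> A y -> edist (f x) (f y) = edist x y) /\ f @` A = B.

Definition ell (R : realType) (m : nat) : set 'rV[R]_1 :=
  [set const_mx i%:R | i in `I_m].
Arguments ell : clear implicits.

Variant color := red | blue.

Definition monochromatic (R : realType) (n : nat) (c : 'rV[R]_n -> color)
    (k : color) (S : set 'rV[R]_n) : Prop :=
  forall x, S x -> c x = k.

(* E^n --> (A, B): red copy of [A] or blue copy of [B] *)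
Definition arrows (R : realType) (n p q : nat)
    (A : set 'rV[R]_p) (B : set 'rV[R]_q) : Prop :=
  forall c : 'rV[R]_n -> color,
    (exists S, isometric_copy A S /\ monochromatic c red S) \/
    (exists S, isometric_copy B S /\ monochromatic c blue S).
Arguments arrows {R} n {p q} A B.

Definition log2 (R : realType) (x : R) : R := ln x / ln 2.

Lemma edist_ell (R : realType) (a b : R) :
  edist (const_mx a : 'rV[R]_1) (const_mx b) = `|a - b|.
Proof. by rewrite /edist big_ord1 !mxE sqrtr_sqr. Qed.

Lemma edistC (R : realType) n (x y : 'rV[R]_n) : edist x y = edist y x.
Proof.
by rewrite /edist; congr Num.sqrt; apply: eq_bigr => i _; rewrite -sqrrN opprB.
Qed.

Lemma edistxx (R : realType) n (x : 'rV[R]_n) : edist x x = 0.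
Proof. by rewrite /edist big1 ?sqrtr0// => i _; rewrite subrr expr0n. Qed.

Lemma not_arrows_ell2P (R : realType) (n q : nat) (K : set 'rV[R]_q) :
  ~ arrows n (ell R 2) K <->
  exists c : 'rV[R]_n -> color,
    (forall x y, c x = red -> c y = red -> edist x y <> 1) /\
    (forall S, isometric_copy K S -> exists2 x, S x & c x = red).
Proof.
have ell01 (x : 'rV[R]_1) : ell R 2 x -> x = const_mx 0 \/ x = const_mx 1.
  by move=> [[|[|//]]] _ <-; [left|right].
split.
  move=> /existsNP[c /not_orP[nred nblue]]; exists c; split.
    move=> x y cx cy xy1; apply: nred.
    pose f (z : 'rV[R]_1) := if z 0 0 == 0 then x else y.
    have f0 : f (const_mx 0) = x by rewrite /f mxE eqxx.
    have f1 : f (const_mx 1) = y by rewrite /f mxE oner_eq0.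
    exists (f @` ell R 2); split; last first.
      by move=> _ [z /ell01[] -> <-]; rewrite ?f0 ?f1.
    exists f; split=> // u v /ell01[] -> /ell01[] ->;
      rewrite ?f0 ?f1 ?edistxx// edist_ell ?(sub0r, subr0) ?normrN normr1 //.
    by rewrite edistC.
  move=> S KS; apply: contrapT => nS; apply: nblue; exists S; split=> // x Sx.
  by case cx : (c x) => //; case: nS; exists x.
move=> [c [nred nblue]] /(_ c)[[S [[f [fE <-]] mono]]|[S [KS mono]]].
  have e0 : ell R 2 (const_mx 0) by exists 0%N.
  have e1 : ell R 2 (const_mx 1) by exists 1%N.
  apply: (nred (f (const_mx 0)) (f (const_mx 1))).
  - by apply: mono; exists (const_mx 0).
  - by apply: mono; exists (const_mx 1).
  - by rewrite fE// edist_ell sub0r normrN normr1.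
by have [x Sx] := nblue _ KS; rewrite mono.
Qed.

(* Main.v *)
Require Import Defs.
From mathcomp Require Import all_boot all_order all_algebra.
From mathcomp Require Import zify ring lra.
Set Implicit Arguments.
Unset Strict Implicit.
Unset Printing Implicit Defensive.
Import Order.TTheory GRing.Theory Num.Theory.
Local Open Scope ring_scope.

(* The red set is random and periodic. On a grid of mesh [2 / (3 sqrt n)],
   taken modulo a period of about [r + 4], each point is independently active
   with probability [1 / (2 q)], where [q] bounds the number of grid points in
   a ball of radius 2. The red points are those at distance less than [1/2]
   from an active grid point that has no other active point at distance less
   than 2; no two of them are at distance 1. A given point is red with
   probability at least [1 / (4 q)], and these events are independent for the
   images of a 5-separated part of [K], which contains at least [|K| / N]
   points. Up to a small perturbation an isometric copy of [K] is described by
   the images of at most [n + 1] well-chosen points, so that there are at most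
   [r ^ (2 n + 5)(n + n^2)] copies to consider, and the union bound concludes
   as [q <= 17 ^ n] and [N <= 33 ^ n] (for [n = 1], [q <= 7] and [N <= 13]). *)

(** Take [I] separated of maximum cardinality: a point related to no member of [I] could be added,
    so the neighbourhoods of its members cover [T]. *)
Lemma separated_subset (T : finType) (e : rel T) N :
  reflexive e -> symmetric e -> (forall x, (#|[set y | e x y]| <= N)%N) ->
  exists I : {set T},
    {in I &, forall x y, x != y -> ~~ e x y} /\ (#|T| <= #|I| * N)%N.
Proof.
move=> er es eN.
pose sep (I : {set T}) := [forall x in I, forall y in I, (x != y) ==> ~~ e x y].
have sep0 : sep set0 by apply/forall_inP => x; rewrite inE.
pose I := [arg max_(I > set0 | sep I) #|I|].
have [sepI maxI] : sep I /\ forall J, sep J -> (#|J| <= #|I|)%N.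
  by rewrite /I; case: arg_maxnP.
have sepIP : {in I &, forall x y, x != y -> ~~ e x y}.
  move=> x y xI yI xy; move/forall_inP : sepI => /(_ x xI)/forall_inP/(_ y yI).
  by rewrite xy.
exists I; split => //.
have cov : [set: T] \subset \bigcup_(x in I) [set y | e x y].
  apply/subsetP => y _; apply: contraT => /bigcupP yn.
  have yI x : x \in I -> ~~ e x y.
    by move=> xI; apply/negP => exy; apply: yn; exists x; rewrite ?inE.
  have /maxI : sep (y |: I).
    apply/forall_inP => u /setU1P[->|uI]; apply/forall_inP => v /setU1P[->|vI].
    - by rewrite eqxx.
    - by rewrite es yI// implybT.
    - by rewrite yI// implybT.
    - by apply/implyP; exact: sepIP.
  rewrite cardsU1; case: (boolP (y \in I)) => [/yI|_]; first by rewrite er.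
  by rewrite add1n ltnn.
rewrite -cardsT (leq_trans (subset_leq_card cov))// -sum_nat_const.
elim/big_rec2: _ => [|x m B _ hB]; first by rewrite cards0.
by apply: leq_trans (leq_card_setU _ _) _; exact: leq_add.
Qed.

(** * Independence under the uniform measure on functions, by counting *)

Section Independence.
Variables (V Q : finType).
Implicit Types (N : {set V}) (X : {set {ffun V -> Q}}).

Definition depends_on N X :=
  forall w w' : {ffun V -> Q}, {in N, w =1 w'} -> (w \in X) = (w' \in X).

Lemma depends_onI N X Y :
  depends_on N X -> depends_on N Y -> depends_on N (X :&: Y).
Proof. by move=> dX dY w w' ww'; rewrite !inE (dX _ _ ww') (dY _ _ ww'). Qed.

Lemma depends_onC N X : depends_on N X -> depends_on N (~: X).
Proof. by move=> dX w w' ww'; rewrite !inE (dX _ _ ww'). Qed.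

Lemma depends_onS N N' X : N \subset N' -> depends_on N X -> depends_on N' X.
Proof.
by move=> /subsetP sN dX w w' ww'; apply: dX => v /sN; exact: ww'.
Qed.

(* Exchanging the values of [w] and [w'] on [N] is an involution of the
   pairs [(w, w')]. *)
Lemma card_indep N X Y : depends_on N X -> depends_on (~: N) Y ->
  (#|X :&: Y| * #|{ffun V -> Q}| = #|X| * #|Y|)%N.
Proof.
move=> dX dY.
pose mix (u v : {ffun V -> Q}) := [ffun x => if x \in N then u x else v x].
pose sw (p : {ffun V -> Q} * {ffun V -> Q}) := (mix p.1 p.2, mix p.2 p.1).
have swK : involutive sw.
  by case=> u v; rewrite /sw /=; congr pair; apply/ffunP=> x; rewrite !ffunE; case: (x \in N).
rewrite -cardsT -!cardsX -(card_imset _ (inv_inj swK)).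
apply: eq_card => -[u v]; rewrite -{1}[(u, v)]swK (mem_imset _ _ (inv_inj swK)).
rewrite !inE /= andbT (dX _ u) ?(dY _ v)// => x; rewrite ?inE ffunE;
  by case: (x \in N).
Qed.

End Independence.

(** Bernoulli's inequality [(1 - 1 / Q) ^ j >= 1 - j / Q], cleared of denominators. *)
Lemma Bernoulli_nat Q j : (j <= Q -> Q ^ j * (Q - j) <= Q.-1 ^ j * Q)%N.
Proof.
elim: j => [|j IHj] jQ; first by rewrite !expn0 subn0.
have := IHj (ltnW jQ); rewrite !expnS => h.
apply: (@leq_trans (Q.-1 * (Q ^ j * (Q - j)))); last by rewrite -mulnA leq_mul2l h orbT.
rewrite -mulnA mulnCA (mulnCA Q.-1) leq_mul2l; apply/orP; right.
nia.
Qed.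

(** * The random set of active vertices and the union bound *)

Section Hitting.
Variables (V : finType) (N : V -> {set V}) (q : nat).
Hypothesis N_refl : forall v, v \in N v.
Hypothesis N_card : forall v, (#|N v| <= q)%N.

(** The value [0], of probability [1 / (2 * q)], marks an active vertex. For [q > 0] the bound is
    [2 * q], in successor form so that [ord0] exists. *)
Definition isolated_zeros (c : V) : {set {ffun V -> 'I_(q + q).-1.+1}} :=
  [set w : {ffun V -> _} | (w c == ord0) && [forall v in N c :\ c, w v != ord0]].

Let q_gt0 (v : V) : (0 < q)%N.
Proof. by apply: leq_trans (N_card v); rewrite card_gt0; apply/set0Pn; exists v. Qed.

Lemma depends_isolated_zeros c : depends_on (N c) (isolated_zeros c).
Proof.
move=> w w' ww'; rewrite !inE ww' //; congr andb.
apply: eq_forallb_in => v; rewrite inE => /andP[_ vN]; by rewrite ww'.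
Qed.

(** The vertex [c] is active with probability [1 / (2 * q)], and its fewer than [q] neighbours are
    all inactive with probability at least [1 / 2] by Bernoulli's inequality. *)
Lemma card_isolated_zeros c :
  (#|{ffun V -> 'I_(q + q).-1.+1}| <= 4 * q * #|isolated_zeros c|)%N.
Proof.
have q0 := q_gt0 c.
set Q := (q + q).-1.+1; have QE : Q = (q + q)%N by rewrite /Q prednK// addn_gt0 q0.
(* The event constrains each value separately, so its cardinality is a product. *)
pose F v : {set 'I_Q} := if v == c then [set ord0]
  else if v \in N c then [set~ ord0] else setT.
have -> : #|isolated_zeros c| = #|family F|.
  apply: eq_card => w; rewrite !inE; apply/andP/familyP.
    move=> [/eqP wc /forall_inP h] v; rewrite /F; case: eqP => [->|/eqP vc]; first by rewrite wc inE.
    by case: ifP => vN; rewrite !inE//; apply: h; rewrite !inE vc.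
  move=> h; split; first by move: (h c); rewrite /F eqxx inE.
  by apply/forall_inP => v; rewrite !inE => /andP[/negbTE vc vN]; move: (h v);
    rewrite /F vc vN !inE.
rewrite card_family card_ffun card_ord foldrE big_map big_enum /=.
rewrite (bigD1 c)//= {1}/F eqxx cards1 mul1n.
rewrite (bigID (mem (N c)))/=.
rewrite [X in (_ <= _ * (X * _))%N](eq_bigr (fun _ => Q.-1)); last first.
  move=> v /andP[/negbTE vc vN]; rewrite /F vc vN cardsC1 card_ord //.
rewrite [X in (_ <= _ * (_ * X))%N](eq_bigr (fun _ => Q)); last first.
  by move=> v /andP[/negbTE vc /negbTE vN]; rewrite /F vc vN cardsT card_ord.
rewrite !prod_nat_const.
have c1 : #|[pred i | (i != c) && (i \in N c)]| = #|N c|.-1.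
  rewrite (cardsD1 c (N c)) N_refl /=; apply: eq_card => v; by rewrite !inE.
have c2 : #|V| = (#|N c| + #|[pred i | (i != c) && (i \notin N c)]|)%N.
  rewrite -(cardC (mem (N c))); congr addn; apply: eq_card => v; rewrite !inE.
  by case: eqP => // ->; rewrite N_refl.
rewrite c1 c2 expnD mulnA leq_mul2r; apply/orP; right.
have Nc := N_card c; have N0 : (0 < #|N c|)%N by rewrite card_gt0; apply/set0Pn; exists c.
rewrite -{1}(prednK N0); set j := #|N c|.-1.
have jq : (j < q)%N by rewrite /j prednK.
have := @Bernoulli_nat Q j; rewrite expnS => /(_ ltac:(lia)) h.
have h2 : (Q ^ j * q <= Q.-1 ^ j * Q)%N by apply: leq_trans h; rewrite leq_mul2l; lia.
have := expn_gt0 Q j; nia.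
Qed.

(** Induction on [I]: the event at [x] is independent of the others, which live on neighbourhoods
    disjoint from [N (c x)], so avoiding it costs a factor [1 - 1 / (4 * q)]. *)
Lemma card_no_isolated_zeros (R : realFieldType) (X : finType) (I : {set X}) (c : X -> V) :
  {in I &, forall x y, x != y -> [disjoint N (c x) & N (c y)]} ->
  #|\bigcap_(x in I) ~: isolated_zeros (c x)|%:R <=
  #|{ffun V -> 'I_(q + q).-1.+1}|%:R * (1 - (4 * q)%:R^-1) ^+ #|I| :> R.
Proof.
elim: {I}_.+1 {-2}I (ltnSn #|I|) => // m IHm I; rewrite ltnS.
have [->|[x xI]] := set_0Vmem I; first by rewrite big_set0 cards0 expr0 mulr1 cardsT.
rewrite (cardsD1 x I) xI add1n => Im disj.
set Om := #|{ffun V -> 'I_(q + q).-1.+1}|.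
rewrite (big_setD1 x xI)/=; set Y := \bigcap_(y in _) _.
have dY : depends_on (~: N (c x)) Y.
  apply: (big_ind (depends_on _)).
  - by move=> w w' _; rewrite !inE.
  - by move=> ? ?; exact: depends_onI.
  - move=> y; rewrite in_setD1 => /andP[yx yI]; apply: depends_onC.
    apply: depends_onS (@depends_isolated_zeros (c y)).
    by rewrite -disjoints_subset; exact: disj.
have hY : #|Y|%:R <= Om%:R * (1 - (4 * q)%:R^-1) ^+ #|I :\ x| :> R.
  by apply: IHm => // y z /setD1P[_ yI] /setD1P[_ zI]; exact: disj.
have ind := card_indep (@depends_isolated_zeros (c x)) dY.
have hc := card_isolated_zeros (c x).
have hsum : (#|isolated_zeros (c x) :&: Y| + #|~: isolated_zeros (c x) :&: Y| = #|Y|)%N.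
  by rewrite -(cardsID (isolated_zeros (c x)) Y) setIC; congr addn; rewrite setDE setIC.
have q0 : 0 < (4 * q)%:R :> R by rewrite ltr0n muln_gt0 (q_gt0 (c x)).
have Om0 : (0 < Om)%N by apply/card_gt0P; exists [ffun=> ord0].
have h : (#|Y| <= 4 * q * #|isolated_zeros (c x) :&: Y|)%N.
  rewrite -(leq_pmul2r Om0) -mulnA ind mulnA mulnC leq_mul2r; apply/orP; right; exact: hc.
rewrite exprS mulrCA; apply: le_trans (ler_wpM2l _ hY); last first.
  by rewrite subr_ge0 invf_le1// ler1n muln_gt0 (q_gt0 (c x)).
have {}hsum : #|isolated_zeros (c x) :&: Y|%:R + #|~: isolated_zeros (c x) :&: Y|%:R
    = #|Y|%:R :> R by rewrite -natrD hsum.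
have {}h : (4 * q)%:R^-1 * #|Y|%:R <= #|isolated_zeros (c x) :&: Y|%:R :> R.
  by rewrite ler_pdivrMl// -natrM ler_nat.
by lra.
Qed.

(** The events of missing all of [I], one for each [j], do not cover the space; any [w] outside them
    yields [A] as its set of isolated zeros. *)
Lemma exists_hitting_independent_set (R : realFieldType) (J X : finType) (P : pred J)
    (I : {set X}) (c : J -> X -> V) :
  (forall j, P j ->
    {in I &, forall x y, x != y -> [disjoint N (c j x) & N (c j y)]}) ->
  #|J|%:R * (1 - (4 * q)%:R^-1) ^+ #|I| < 1 :> R ->
  exists A : {set V},
    {in A &, forall v w, w \in N v -> w = v} /\
    forall j, P j -> exists2 x, x \in I & c j x \in A.
Proof.
move=> disj small.
pose bad j := \bigcap_(x in I) ~: isolated_zeros (c j x).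
have [w wbad] : exists w, w \notin \bigcup_(j | P j) bad j.
  apply/existsP; apply: contraTT small; rewrite negb_exists => /forallP h.
  set Om := #|{ffun V -> 'I_(q + q).-1.+1}|.
  have Om0 : (0 < Om)%N by apply/card_gt0P; exists [ffun=> ord0].
  have hOm : (Om <= \sum_(j | P j) #|bad j|)%N.
    apply: (@leq_trans #|\bigcup_(j | P j) bad j|).
      by apply: subset_leq_card; apply/subsetP => w _; move: (h w); rewrite negbK.
    elim/big_rec2: _ => [|j B m _ hB]; first by rewrite cards0.
    by apply: leq_trans (leq_card_setU _ _) _; rewrite leq_add2l.
  rewrite -leNgt -(ler_pM2l (_ : 0 < Om%:R)) ?ltr0n// mulr1.
  move: hOm; rewrite -(ler_nat R) natr_sum => /le_trans; apply.
  rewrite mulrCA mulr_natl -sumr_const big_mkcond/=; apply: ler_sum => j _.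
  case: ifP => Pj; first by apply: card_no_isolated_zeros; exact: disj.
  rewrite mulr_ge0// exprn_ge0// subr_ge0.
  (* For [q = 0] the inverse is [0] by convention. *)
  have [->|q0] := posnP q; first by rewrite muln0 invr0.
  by rewrite invf_le1 ?ler1n ?ltr0n ?muln_gt0.
exists [set v | w \in isolated_zeros v]; split.
  move=> v u; rewrite !inE => /andP[_ /forall_inP hv] /andP[u0 _] uN.
  by apply: contraTeq u0 => uv; apply: hv; rewrite !inE uv.
move=> j Pj.
move/bigcupP: wbad => wbad; have : w \notin bad j.
  by apply/negP => wj; apply: wbad; exists j.
move=> wj; apply/exists_inP; apply: contraNT wj => /exists_inPn h.
by apply/bigcapP => x xI; rewrite inE; move: (h x xI); rewrite inE.
Qed.

End Hitting.

(** * Linear relations between rows, and Gram matrices *)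

(* A choice of rows with maximal determinant: by Cramer's rule the
   coefficients of all the other rows are then bounded by [1]. *)
Lemma bounded_row_basis (F : realFieldType) k n (M : 'M[F]_(k, n)) :
  exists d (g : 'I_d -> 'I_k) (T : 'M[F]_(k, d)),
    [/\ (d <= n)%N, forall i j, `|T i j| <= 1 & M = T *m rowsub g M].
Proof.
(* [col_base M] has [\rank M] columns and full column rank, so some square selection of its rows is
   invertible. *)
pose C := col_base M; pose det_of (h : {ffun 'I_(\rank M) -> 'I_k}) := \det (rowsub h C).
pose g0 : {ffun 'I_(\rank M) -> 'I_k} := finfun (fullrankfun (col_base_full M)).
have g0N0 : det_of g0 != 0.
  rewrite /det_of -unitfE -unitmxE.
  rewrite (_ : rowsub _ _ = rowsub (fullrankfun (col_base_full M)) C) ?fullrowsub_unit//.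
  by apply/matrixP => i j; rewrite !mxE ffunE.
pose g := [arg max_(h > g0) `|det_of h|]%O.
have gmax h : `|det_of h| <= `|det_of g|.
  by rewrite /g; case: arg_maxP => // h' _ /(_ h); apply.
have gN0 : det_of g != 0 by rewrite -normr_gt0 (lt_le_trans _ (gmax g0))// normr_gt0.
pose D := rowsub g C; have Du : D \in unitmx by rewrite unitmxE unitfE.
exists (\rank M), g, (C *m invmx D); split; first exact: rank_leq_col.
  (* Replacing the [j]-th selected row by row [i] multiplies the determinant by the coefficient at
     [i j]. *)
  move=> i j; pose h := [ffun l => if l == j then i else g l].
  have -> : (C *m invmx D) i j = (det_of g)^-1 * det_of h.
    rewrite /invmx Du -scalemxAr mxE; congr (_ * _).
    rewrite [RHS](expand_det_row _ j) mxE; apply: eq_bigr => l _.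
    rewrite !mxE ffunE eqxx; congr (_ * (_ * \det _)).
    apply/matrixP => a b; rewrite !mxE ffunE.
    by rewrite eq_sym (negbTE (neq_lift _ _)).
  by rewrite normrM normfV ler_pdivrMl ?normr_gt0// mulr1.
have CM : C *m row_base M = M by rewrite mulmx_base.
have -> : rowsub g M = D *m row_base M by rewrite mul_rowsub_mx CM.
by rewrite -mulmxA mulKmx// CM.
Qed.

Lemma mulmx_tr_eq0 (F : realFieldType) m n (N : 'M[F]_(m, n)) : N *m N^T = 0 -> N = 0.
Proof.
move=> h; apply/matrixP => i j; rewrite mxE.
have : (N *m N^T) i i = 0 by rewrite h mxE.
rewrite mxE => /eqP; rewrite psumr_eq0; last by move=> l _; rewrite mxE -expr2 sqr_ge0.
by move=> /allP/(_ j (mem_index_enum _)); rewrite mxE -expr2 sqrf_eq0 => /eqP.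
Qed.

(** A relation [E *m M = 0] depends only on the Gram matrix, being equivalent to
    [E *m (M *m M^T) *m E^T = 0]. *)
Lemma eq_gram_mul (F : realFieldType) k d m n (g : 'I_d -> 'I_k) (T : 'M[F]_(k, d))
    (M : 'M[F]_(k, m)) (M' : 'M[F]_(k, n)) :
  M *m M^T = M' *m M'^T -> M = T *m rowsub g M -> M' = T *m rowsub g M'.
Proof.
move=> gram MT; pose E := 1%:M - T *m rowsub g 1%:M.
have EM p (A : 'M_(k, p)) : E *m A = A - T *m rowsub g A.
  by rewrite mulmxBl mul1mx -mulmxA mul_rowsub_mx mul1mx.
have : E *m M' = 0.
  apply: mulmx_tr_eq0; rewrite trmx_mul !mulmxA -(mulmxA E) -gram !mulmxA EM -MT.
  by rewrite subrr !mul0mx.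
by rewrite EM => /eqP; rewrite subr_eq0 => /eqP.
Qed.

(** * Counting integer vectors of bounded l^1 norm *)

Section IntegerVectors.
Variables (n b : nat) (s : seq 'rV[int]_n).
Hypothesis s_uniq : uniq s.
Hypothesis s_le : forall z, z \in s -> (\sum_i absz (z 0%R i) <= b * n)%N.

Let B := (b * n)%N.
Let shift (z : 'rV[int]_n) : {ffun 'I_n -> 'I_(2 * B).+1} :=
  [ffun i => inord (absz (z 0 i + B%:Z)%R)].

Let shiftE z i : z \in s -> shift z i = absz (z 0 i + B%:Z)%R :> nat.
Proof.
move=> zs; rewrite ffunE inordK//.
have := s_le zs; rewrite (bigD1 i)//= -/B; lia.
Qed.

Let shiftE' z i : z \in s -> (shift z i)%:Z - B%:Z = z 0 i.
Proof.
move=> zs; rewrite (shiftE _ zs).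
have := s_le zs; rewrite (bigD1 i)//= -/B; lia.
Qed.

Let shift_uniq : uniq (map shift s).
Proof.
rewrite map_inj_in_uniq// => z w zs ws zw; apply/rowP => i.
by rewrite -(shiftE' i zs) -(shiftE' i ws) zw.
Qed.

Lemma size_cube_le : (size s <= (2 * (b * n)).+1 ^ n)%N.
Proof.
rewrite -(size_map shift) -(card_uniqP shift_uniq) (leq_trans (max_card _))//.
by rewrite card_ffun !card_ord.
Qed.

Let geom_sum (x : rat) m : 0 <= x < 1 -> \sum_(i < m) x ^+ i <= (1 - x)^-1.
Proof.
move=> /andP[x0 x1]; rewrite -[leRHS]mul1r ler_pdivlMr ?subr_gt0//.
rewrite -[leLHS]opprK -mulrN opprB mulrC -subrX1 opprB gerBl; exact: exprn_ge0.
Qed.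

(* Weigh [z] by [x ^ |z|_1] with [x = b / (b + 1)]. *)
Lemma size_l1_ball_le :
  (0 < b)%N -> (size s * (b ^ b) ^ n <= (b.+1 ^ b * (2 * b).+1) ^ n)%N.
Proof.
move=> b0; pose x : rat := b%:R / b.+1%:R.
have x01 : 0 < x < 1.
  by rewrite divr_gt0 ?ltr0n//= ltr_pdivrMr ?ltr0n// mul1r ltr_nat ltnSn.
have [x0 x1] := andP x01.
pose w (y : {ffun 'I_n -> 'I_(2 * B).+1}) := \prod_i x ^+ (absz ((y i)%:Z - B%:Z)%R).
have w0 y : 0 <= w y by apply: prodr_ge0 => i _; rewrite exprn_ge0// ltW.
have lo : (size s)%:R * x ^+ B <= \sum_(y <- map shift s) w y.
  rewrite -sum1_size natr_sum mulr_suml big_map big_seq [leRHS]big_seq.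
  apply: ler_sum => z zs; rewrite mul1r.
  rewrite [leRHS](eq_bigr (fun i => x ^+ (absz (z 0%R i)))); last by move=> i _; rewrite shiftE'.
  rewrite prodrXr; apply: ler_wiXn2l; rewrite ?ltW//; exact: s_le.
(* Over the whole cube the sum factors into [n] truncated two-sided geometric series, each at most
   [(1 + x) / (1 - x) = 2 * b + 1]. *)
have up : \sum_(y <- map shift s) w y <= (2 * b).+1%:R ^+ n.
  apply: (@le_trans _ _ (\sum_y w y)).
    rewrite big_uniq//= [leRHS](bigID [in map shift s])/= lerDl; exact: sumr_ge0.
  rewrite -(bigA_distr_bigA (fun _ j => x ^+ (absz ((val j)%:Z - B%:Z)%R)))/=.
  rewrite prodr_const card_ord; apply: lerXn2r; rewrite ?nnegrE ?ler0n//.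
    by apply: sumr_ge0 => j _; rewrite exprn_ge0// ltW.
  rewrite -(big_mkord xpredT (fun j => x ^+ (absz (j%:Z - B%:Z)%R))).
  rewrite (@big_cat_nat _ _ _ B)//=; last lia.
  rewrite big_nat_rev/= add0n.
  rewrite [X in X + _](eq_big_nat _ _ (F2 := fun i => x * x ^+ i)); last first.
    by move=> i iB; rewrite -exprS; congr (_ ^+ _); lia.
  rewrite -{2}[B]add0n big_addn.
  rewrite [X in _ + X](eq_big_nat _ _ (F2 := fun i => x ^+ i)); last first.
    by move=> i iB; congr (_ ^+ _); lia.
  rewrite -mulr_sumr !big_mkord.
  have g1 := @geom_sum x B ltac:(by rewrite ltW). 
  have g2 := @geom_sum x ((2 * B).+1 - B) ltac:(by rewrite ltW).
  apply: (@le_trans _ _ ((1 + x) * (1 - x)^-1)).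
    by rewrite mulrDl mul1r addrC lerD// ler_wpM2l// ltW.
  have bb : b.+1%:R = b%:R + 1 :> rat by rewrite -natr1.
  have -> : (1 - x)^-1 = b.+1%:R.
    rewrite /x bb; have : b%:R + 1 != 0 :> rat by rewrite -bb pnatr_eq0.
    move=> h; have -> : 1 - b%:R / (b%:R + 1) = (b%:R + 1)^-1 :> rat by field.
    by rewrite invrK.
  by rewrite mulrDl mul1r /x divfK ?pnatr_eq0// -natrD ler_nat; lia.
have := le_trans lo up; rewrite /x expr_div_n mulrA ler_pdivrMr ?exprn_gt0 ?ltr0n//.
by rewrite -!natrX -!natrM ler_nat /B !expnM expnMn mulnC [leqRHS]mulnC [leqLHS]mulnC.
Qed.

End IntegerVectors.

From mathcomp Require Import finmap all_classical all_reals all_analysis.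
Local Notation edist := Defs.edist.

(** * Euclidean distance and packing *)

Section Euclidean.
Variables (R : realType).

(** Lagrange's identity writes twice the difference of the sides as a double sum of squares. *)
Lemma Cauchy_Schwarz n (u v : 'I_n -> R) :
  (\sum_i u i * v i) ^+ 2 <= (\sum_i u i ^+ 2) * (\sum_i v i ^+ 2).
Proof.
set a := \sum_i u i ^+ 2; set b := \sum_i v i ^+ 2; set c := \sum_i _.
suff : 0 <= a * b + b * a - 2 * c * c by nra.
have -> : a * b + b * a - 2 * c * c = \sum_i \sum_j (u i * v j - u j * v i) ^+ 2.
  transitivity (\sum_i (u i ^+ 2 * b + v i ^+ 2 * a - 2 * (u i * v i) * c)).
    by rewrite sumrB big_split/= -!mulr_suml -mulr_sumr.
  apply: eq_bigr => i _; rewrite !mulr_sumr -big_split /= -sumrB.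
  by apply: eq_bigr => j _; ring.
by apply: sumr_ge0 => i _; apply: sumr_ge0 => j _; exact: sqr_ge0.
Qed.

Variable n : nat.
Implicit Types (x y z : 'rV[R]_n).

Lemma edist_ge0 x y : 0 <= edist x y. Proof. exact: sqrtr_ge0. Qed.

Lemma sqr_edist x y : edist x y ^+ 2 = \sum_i (x 0 i - y 0 i) ^+ 2.
Proof. by rewrite sqr_sqrtr// sumr_ge0// => i _; exact: sqr_ge0. Qed.

Lemma edist_triangle y x z : edist x z <= edist x y + edist y z.
Proof.
rewrite -(ler_pXn2r (n := 2)) ?nnegrE ?addr_ge0 ?edist_ge0// sqrrD !sqr_edist.
have -> : \sum_i (x 0 i - z 0 i) ^+ 2 = \sum_i (x 0 i - y 0 i) ^+ 2
    + \sum_i (y 0 i - z 0 i) ^+ 2 + 2 * \sum_i (x 0 i - y 0 i) * (y 0 i - z 0 i).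
  by rewrite mulr_sumr -!big_split/=; apply: eq_bigr => i _; ring.
rewrite addrAC lerD2r lerD2l -[leRHS]mulr_natl.
rewrite ler_pM2l ?ltr0n//; apply: le_trans (ler_norm _) _.
rewrite -(ler_pXn2r (n := 2)) ?nnegrE ?mulr_ge0 ?edist_ge0//.
by rewrite real_normK ?num_real// exprMn !sqr_edist; exact: Cauchy_Schwarz.
Qed.

Lemma coord_le_edist x y i : `|x 0 i - y 0 i| <= edist x y.
Proof.
rewrite -(ler_pXn2r (n := 2)) ?nnegrE ?edist_ge0// sqr_edist real_normK ?num_real//.
by rewrite (bigD1 i)//= lerDl sumr_ge0// => j _; exact: sqr_ge0.
Qed.

Lemma sum_norm_le_edist x y :
  \sum_i `|x 0 i - y 0 i| <= Num.sqrt n%:R * edist x y.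
Proof.
rewrite -(ler_pXn2r (n := 2)) ?nnegrE ?mulr_ge0 ?sqrtr_ge0 ?edist_ge0//; last first.
  by apply: sumr_ge0 => i _.
rewrite exprMn sqr_sqrtr ?ler0n// sqr_edist.
have := Cauchy_Schwarz (fun=> 1) (fun i => `|x 0 i - y 0 i|).
under eq_bigr => i _ do rewrite mul1r.
under [X in _ <= X * _]eq_bigr => i _ do rewrite expr1n.
under [X in _ <= _ * X]eq_bigr => i _ do rewrite real_normK ?num_real//.
by rewrite sumr_const card_ord.
Qed.

Lemma edist_le_coord (e : R) x y : 0 <= e ->
  (forall i, `|x 0 i - y 0 i| * Num.sqrt n%:R <= e) -> edist x y <= e.
Proof.
move=> e0 h; case: (posnP n) => [n0|n0].
  rewrite /edist big1 ?sqrtr0// => i; by have := ltn_ord i; rewrite {2}n0.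
rewrite -(ler_pXn2r (n := 2)) ?nnegrE ?edist_ge0// sqr_edist.
rewrite -(ler_pM2l (_ : 0 < n%:R :> R)) ?ltr0n// mulr_sumr.
apply: (@le_trans _ _ (\sum_(i < n) e ^+ 2)); last by rewrite sumr_const card_ord mulr_natl.
apply: ler_sum => i _.
rewrite -[n%:R]sqr_sqrtr ?ler0n// -exprMn mulrC -real_normK ?num_real//.
by rewrite normrM (ger0_norm (sqrtr_ge0 _)) ler_pXn2r ?nnegrE ?mulr_ge0 ?sqrtr_ge0.
Qed.

Lemma edist_lt_coord (e : R) x y : (0 < n)%N ->
  (forall i, `|x 0 i - y 0 i| * Num.sqrt n%:R < e) -> edist x y < e.
Proof.
move=> n0 h.
have e0 : 0 < e by apply: le_lt_trans (h (Ordinal n0)); rewrite mulr_ge0 ?sqrtr_ge0.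
rewrite -(ltr_pXn2r (n := 2)) ?nnegrE ?edist_ge0 ?ltW// sqr_edist.
rewrite -(ltr_pM2l (_ : 0 < n%:R :> R)) ?ltr0n// mulr_sumr.
have -> : n%:R * e ^+ 2 = \sum_(i < n) e ^+ 2 by rewrite sumr_const card_ord mulr_natl.
have hi i : n%:R * (x 0 i - y 0 i) ^+ 2 < e ^+ 2.
  rewrite -[n%:R]sqr_sqrtr ?ler0n// -exprMn mulrC -real_normK ?num_real//.
  by rewrite normrM (ger0_norm (sqrtr_ge0 _)) ltr_pXn2r ?nnegrE ?mulr_ge0 ?sqrtr_ge0// ltW.
apply: ltr_sum => //; apply/hasP; exists (Ordinal n0); by rewrite ?mem_index_enum.
Qed.

Lemma edistD2r z x y : edist (x + z) (y + z) = edist x y.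
Proof. by congr Num.sqrt; apply: eq_bigr => i _; rewrite !mxE; ring. Qed.

Lemma edist_subr x y : edist x y = edist (x - y) 0.
Proof. by rewrite -(edistD2r y (x - y)) subrK add0r. Qed.

(* By Cauchy-Schwarz, the integer points of a Euclidean ball of radius
   [b * sqrt n] have l^1 norm at most [b * n]. *)
Definition l1_ball_card_le b N := forall s : seq 'rV[int]_n, uniq s ->
  (forall v, v \in s -> (\sum_i absz (v 0%R i) <= b * n)%N) -> (size s <= N)%N.

Lemma l1_ball_card_le_inj (T : finType) b N (A : {set T}) (f : T -> 'rV[int]_n) :
  l1_ball_card_le b N -> {in A &, injective f} ->
  (forall t, t \in A -> \sum_i `|(f t 0 i)%:~R| <= (b * n)%:R :> R) -> (#|A| <= N)%N.
Proof.
move=> bN fi fb; rewrite cardE -(size_map f); apply: bN.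
  by rewrite map_inj_in_uniq ?enum_uniq// => x y; rewrite !mem_enum; exact: fi.
move=> v /mapP[x]; rewrite mem_enum => xA ->; rewrite -(ler_nat R) natr_sum.
apply: le_trans (fb _ xA); apply: ler_sum => i _.
by rewrite -intr_norm -abszE.
Qed.

(** Index points by cells of side [1 / sqrt n], relative to [p i]. Points in one cell are at
    distance less than [1]; the l^1 norm of an index is at most [5 * n] by Cauchy-Schwarz, plus [n]
    for rounding. *)
Lemma card_close_points N k (p : 'I_k -> 'rV[R]_n) : (0 < n)%N ->
  l1_ball_card_le 6 N -> (forall i j, i != j -> 1 <= edist (p i) (p j)) ->
  forall i, (#|[set j | (edist (p i) (p j) < 5)%R]| <= N)%N.
Proof.
move=> n0 hN sep i; set W := Num.sqrt n%:R : R.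
have W0 : 0 < W by rewrite sqrtr_gt0 ltr0n.
pose f j : 'rV[int]_n := \row_l Num.floor ((p j 0 l - p i 0 l) * W).
have fP j l : (f j 0 l)%:~R <= (p j 0 l - p i 0 l) * W < (f j 0 l)%:~R + 1.
  by rewrite mxE -[1]/(1%:~R) -intrD; exact: floor_itv.
apply: (l1_ball_card_le_inj (f := f) hN).
  move=> j j' _ _ /rowP fjj'; apply/eqP; apply: contraT => /sep.
  rewrite leNgt edist_lt_coord// => l.
  rewrite -/W -(gtr0_norm W0) -normrM ltr_norml; have := fP j l; have := fP j' l.
  by rewrite fjj'; lra.
move=> j; rewrite inE => dj.
apply: (@le_trans _ _ (\sum_l (W * `|p j 0 l - p i 0 l| + 1))).
  apply: ler_sum => l _; rewrite -{1}(gtr0_norm W0) -normrM mulrC.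
  have /andP[] := fP j l; set t := _ * W; set u := _%:~R => h1 h2.
  have := ler_norm t; have := ler_norm (- t); rewrite normrN ler_norml => *; lra.
rewrite big_split/= -mulr_sumr sumr_const card_ord.
rewrite (_ : (6 * n)%:R = W * (W * 5) + n%:R); last first.
  by rewrite mulrA -expr2 sqr_sqrtr ?ler0n// natrM; ring.
rewrite lerD2r ler_pM2l//; apply: le_trans (sum_norm_le_edist _ _) _.
by rewrite ler_pM2l// edistC ltW.
Qed.

End Euclidean.

(** * Finite codes for isometric copies *)

Section IsometryCode.
Variables (R : realType) (n k : nat) (p : 'I_k.+1 -> 'rV[R]_n).
Implicit Type f : 'I_k.+1 -> 'rV[R]_n.

Definition preserves_edist f := forall x y, edist (f x) (f y) = edist (p x) (p y).

Definition displacements f : 'M[R]_(k.+1, n) := \matrix_(x, i) (f x 0 i - f ord0 0 i).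

(** By polarization, distances determine the inner products of displacements. *)
Lemma gram_displacements f : preserves_edist f ->
  displacements f *m (displacements f)^T = displacements p *m (displacements p)^T.
Proof.
move=> fp; have gramE h : displacements h *m (displacements h)^T = \matrix_(x, y)
    ((edist (h x) (h ord0) ^+ 2 + edist (h y) (h ord0) ^+ 2 - edist (h x) (h y) ^+ 2) / 2).
  apply/matrixP => x y; rewrite !mxE !sqr_edist -big_split/= -sumrB mulr_suml.
  by apply: eq_bigr => i _; rewrite !mxE; field.
by rewrite !gramE; apply/matrixP => x y; rewrite !mxE !fp.
Qed.

(** The upper bounds matter: [inord] sends all integers out of range to one default value. *)
Lemma eq_inord_truncn C (a b : R) : 0 <= a < C.+1%:R -> 0 <= b < C.+1%:R ->
  inord (Num.truncn a) = inord (Num.truncn b) :> 'I_C.+1 -> `|a - b| < 1.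
Proof.
move=> /andP[a0 aC] /andP[b0 bC] /(congr1 val)/=.
rewrite !inordK ?truncn_lt_nat// => tab.
have /andP[a1 a2] := truncn_itv a0; have /andP[b1 b2] := truncn_itv b0.
rewrite tab in a1 a2; rewrite -natr1 in a2; rewrite -natr1 in b2.
by rewrite ltr_norml; lra.
Qed.

(* An isometry is determined, with control of the error, by the image of one
   point and the displacements of the points of a well-conditioned basis. *)
Lemma isometry_code (D L s : R) (C : nat) : 0 < L -> 0 < s ->
  L < C.+1%:R * s -> 2 * D < C.+1%:R * s -> (forall x y, edist (p x) (p y) <= D) ->
  exists (J : finType) (code : ('I_k.+1 -> 'rV[R]_n) -> J),
    (#|J| <= C.+1 ^ (n + n * n))%N /\
    forall f f', preserves_edist f -> preserves_edist f' -> code f = code f' ->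
      exists t : 'rV[int]_n, forall x i, `|f x 0 i - f' x 0 i - L * (t 0 i)%:~R| < n.+1%:R * s.
Proof.
move=> L0 s0 LC DC pD.
have [d [g [T [dn T1 pT]]]] := bounded_row_basis (displacements p).
(* [tr f] counts the periods that bring the base point into [[0, L)]. In units of [s], [a] is the
   reduced base point and [b] the basis displacements, made nonnegative by adding [D]. *)
pose tr f : 'rV[int]_n := \row_i Num.floor (f ord0 0 i / L).
pose a f (i : 'I_n) := (f ord0 0 i - L * (tr f 0 i)%:~R) / s.
pose b f (l : 'I_d) (i : 'I_n) := (f (g l) 0 i - f ord0 0 i + D) / s.
have aP f i : 0 <= a f i < C.+1%:R.
  rewrite /a divr_ge0 ?(ltW s0)//=; last first.
    by rewrite subr_ge0 mxE mulrC -ler_pdivlMr// floor_le.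
  rewrite ltr_pdivrMr//; apply: le_lt_trans LC; rewrite lerBlDr -[X in X + _]mulr1 -mulrDr.
  rewrite mulrC -ler_pdivrMr// mxE addrC -[1]/(1%:~R) -intrD ltW//; exact: floorD1_gt.
have bP f l i : preserves_edist f -> 0 <= b f l i < C.+1%:R.
  move=> fp; have := coord_le_edist (f (g l)) (f ord0) i; rewrite fp => /le_trans/(_ (pD _ _)).
  rewrite ler_norml => /andP[h1 h2]; rewrite /b divr_ge0 ?(ltW s0)//=; last by lra.
  by rewrite ltr_pdivrMr//; apply: le_lt_trans DC; lra.
pose code f : {ffun 'I_n -> 'I_C.+1} * {ffun 'I_d * 'I_n -> 'I_C.+1} :=
  ([ffun i => inord (Num.truncn (a f i))], [ffun li => inord (Num.truncn (b f li.1 li.2))]).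
exists _, code; split.
  rewrite card_prod !card_ffun card_prod !card_ord -expnD leq_pexp2l//.
  by rewrite leq_add2l leq_mul2r dn orbT.
move=> f f' fp f'p [/ffunP ca /ffunP cb]; exists (tr f - tr f') => x i.
have fE h : preserves_edist h -> h x 0 i - h ord0 0 i
    = \sum_l T x l * (h (g l) 0 i - h ord0 0 i).
  move=> hp; have := eq_gram_mul (esym (gram_displacements hp)) pT.
  move=> /matrixP/(_ x i); rewrite !mxE => ->.
  by apply: eq_bigr => l _; rewrite !mxE.
(* The base point contributes an error below [s] and each of the [d <= n] displacements at most [s],
   as [T] has entries of size at most [1]. *)
have -> : f x 0 i - f' x 0 i - L * ((tr f - tr f') 0 i)%:~R
    = s * (a f i - a f' i) + \sum_l T x l * (s * (b f l i - b f' l i)).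
  rewrite -[f x 0 i](subrK (f ord0 0 i)) -[f' x 0 i](subrK (f' ord0 0 i)) !fE//.
  have -> : \sum_l T x l * (s * (b f l i - b f' l i)) =
      \sum_l T x l * (f (g l) 0 i - f ord0 0 i) - \sum_l T x l * (f' (g l) 0 i - f' ord0 0 i).
    rewrite -sumrB; apply: eq_bigr => l _; rewrite -mulrBr; congr (_ * _).
    by rewrite /b; field; rewrite gt_eqF.
  have -> : ((tr f - tr f') 0 i)%:~R = (tr f 0 i)%:~R - (tr f' 0 i)%:~R :> R.
    by rewrite !mxE intrB.
  by rewrite /a; field; rewrite gt_eqF.
have ha : `|a f i - a f' i| < 1.
  by apply: (@eq_inord_truncn C) => //; have := ca i; rewrite !ffunE.
have hb l : `|b f l i - b f' l i| < 1.
  by apply: (@eq_inord_truncn C); rewrite ?bP//; have := cb (l, i); rewrite !ffunE.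
apply: le_lt_trans (ler_normD _ _) _; rewrite -natr1 mulrDl mul1r addrC ler_ltD//; last first.
  by rewrite normrM gtr0_norm// gtr_pMr.
apply: le_trans (ler_norm_sum _ _ _) _.
apply: (@le_trans _ _ (\sum_(l < d) s)).
  apply: ler_sum => l _; rewrite !normrM (gtr0_norm s0).
  rewrite -[leRHS]mul1r ler_pM ?mulr_ge0 ?(ltW s0)//.
  by rewrite ger_pMr// ltW.
by rewrite sumr_const card_ord -[leLHS]mulr_natl ler_pM2r// ler_nat.
Qed.

End IsometryCode.

(** * The periodic grid and the red balls *)

Section Torus.
Variables (R : realType) (n M : nat) (delta : R).
Hypotheses (M_gt1 : (1 < M)%N) (delta_gt0 : 0 < delta).
Implicit Types (z u t : 'rV[int]_n) (x y : 'rV[R]_n).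

Definition grid_point z : 'rV[R]_n := delta *: map_mx intr z.

Definition residue z : 'rV['Z_M]_n := map_mx intr z.

Lemma grid_pointB z u : grid_point (z - u) = grid_point z - grid_point u.
Proof. by rewrite /grid_point map_mxB scalerBr. Qed.

Lemma grid_pointD z u : grid_point (z + u) = grid_point z + grid_point u.
Proof. by rewrite /grid_point map_mxD scalerDr. Qed.

Lemma residueB z u : residue (z - u) = residue z - residue u.
Proof. exact: map_mxB. Qed.

Lemma residueD z u : residue (z + u) = residue z + residue u.
Proof. exact: map_mxD. Qed.

Lemma residueZ z : residue (M%:Z *: z) = 0.
Proof.
by apply/rowP => i; rewrite !mxE intrM -pmulrn pchar_Zp// mul0r.
Qed.

Lemma residue_eq0 z : residue z = 0 -> exists t, z = M%:Z *: t.
Proof.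
move=> /rowP z0; exists (map_mx (fun m => (m %/ M%:Z)%Z) z); apply/rowP => i; rewrite !mxE.
have := z0 i; rewrite !mxE {1}(divz_eq (z 0 i) M) intrD intrM -pmulrn pchar_Zp// mulr0 add0r.
have M0 : M%:Z != 0 by lia.
have := modz_ge0 (z 0 i) M0; have := ltz_mod (z 0 i) M0.
case E : (z 0%R i %% M)%Z => [m|//] mM _ m0.
have : (m%:R : 'Z_M) = 0%N :> nat by rewrite pmulrn m0.
rewrite val_Zp_nat// modn_small; last by lia.
by move=> {}m0; rewrite {1}(divz_eq (z 0 i) M) E m0 addr0 mulrC.
Qed.

Lemma grid_pointZ t : grid_point (M%:Z *: t) = (delta * M%:R) *: map_mx intr t.
Proof.
apply/rowP => i; rewrite !mxE intrM -pmulrn; ring.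
Qed.

(** Residues carry no distance, so the ball is the image of a ball of integer lifts. *)
Definition torus_ball (c : 'rV['Z_M]_n) : {set 'rV['Z_M]_n} :=
  [set v | `[< exists2 u, edist (grid_point u) 0 < 2 & v = c + residue u >]].

Lemma torus_ball_refl c : c \in torus_ball c.
Proof.
rewrite inE; apply/asboolP; exists 0; last by rewrite /residue map_mx0 addr0.
by rewrite /grid_point map_mx0 scaler0 edistxx.
Qed.

(** By Cauchy-Schwarz a lift has [delta] times its l^1 norm at most [2 * sqrt n], that is, l^1 norm
    at most [3 * n]. *)
Lemma card_torus_ball q c : (0 < n)%N -> delta = 2 / (3 * Num.sqrt n%:R) ->
  l1_ball_card_le n 3 q -> (#|torus_ball c| <= q)%N.
Proof.
move=> n0 dE hq; set W := Num.sqrt n%:R in dE.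
have W0 : 0 < W by rewrite sqrtr_gt0 ltr0n.
have /choice[f fP] w : exists u, w \in torus_ball c ->
    edist (grid_point u) 0 < 2 /\ w = c + residue u.
  case: (boolP (w \in torus_ball c)) => [|_]; last by exists 0.
  by rewrite inE => /asboolP[u]; exists u.
apply: (l1_ball_card_le_inj (R := R) (f := f) hq).
  by move=> v w /fP[_ {2}->] /fP[_ {2}->] ->.
move=> v /fP[fv _]; have := sum_norm_le_edist (grid_point (f v)) 0.
have -> : \sum_i `|grid_point (f v) 0 i - (0 : 'rV_n) 0 i| = delta * \sum_i `|(f v 0 i)%:~R|.
  rewrite mulr_sumr; apply: eq_bigr => i _.
  by rewrite !mxE subr0 normrM (gtr0_norm delta_gt0).
rewrite -/W => h; rewrite -(ler_pM2l delta_gt0); apply: le_trans h _.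
apply: (@le_trans _ _ (W * 2)); first by rewrite ler_pM2l// ltW.
rewrite natrM -(sqr_sqrtr (ler0n R n)) -/W dE le_eqVlt; apply/orP; left; apply/eqP.
by field; rewrite gt_eqF.
Qed.

(** A nonzero [t] moves some coordinate by at least the period, while [x] and [y] differ there by at
    most [D]. *)
Lemma lattice_far x y t e D : edist x y <= D -> D + e <= delta * M%:R -> e <= edist x y ->
  e <= edist x (y + (delta * M%:R) *: map_mx intr t).
Proof.
move=> xyD De exy; have [->|t0] := eqVneq t 0; first by rewrite map_mx0 scaler0 addr0.
have [i ti] : exists i, t 0 i != 0.
  apply/existsP; apply: contraR t0 => /existsPn h; apply/eqP/rowP => i; rewrite mxE.
  by apply/eqP; rewrite -[_ == _]negbK h.
apply: le_trans (coord_le_edist _ _ i); rewrite !mxE.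
have h1 := le_trans (coord_le_edist x y i) xyD.
have Lt : delta * M%:R <= `|delta * M%:R * (t 0 i)%:~R|.
  rewrite normrM ger0_norm ?mulr_ge0 ?(ltW delta_gt0)// ler_peMr ?mulr_ge0 ?(ltW delta_gt0)//.
  by rewrite -intr_norm -[1]/(1%:~R) ler_int; lia.
set a := delta * M%:R * _ in Lt *.
have := ler_normB (x 0 i - y 0 i) (x 0 i - (y 0 i + a)).
by rewrite (_ : _ - _ - _ = a); [lra|ring].
Qed.

(** A common point would link [x] to a translate of [y] by a period vector, at distance less than
    [1/3 + 2 + 2 + 1/3 < 5]. *)
Lemma disjoint_torus_ball x y z u :
  (forall t, 5 <= edist x (y + (delta * M%:R) *: map_mx intr t)) ->
  edist x (grid_point z) <= 3^-1 -> edist y (grid_point u) <= 3^-1 ->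
  [disjoint torus_ball (residue z) & torus_ball (residue u)].
Proof.
move=> far xz yu; rewrite -setI_eq0; apply/eqP/setP => w; rewrite !inE.
apply/negP => /andP[/asboolP[a a2 wa] /asboolP[b b2 wb]].
have [t tE] : exists t, (z + a) - (u + b) = M%:Z *: t.
  by apply: residue_eq0; rewrite residueB !residueD -wa -wb subrr.
have := far t; apply/negP; rewrite -ltNge -grid_pointZ -tE.
set g := grid_point _.
have gE : g = grid_point z + grid_point a - grid_point u - grid_point b.
  by rewrite /g grid_pointB !grid_pointD opprD addrA.
have h1 := edist_triangle (grid_point z) x (y + g).
have h2 := edist_triangle (grid_point u + g) (grid_point z) (y + g).
rewrite edistD2r edistC [edist (grid_point u) y]edistC in h2.
have h3 : edist (grid_point z) (grid_point u + g) <= edist (grid_point a) 0 + edist (grid_point b) 0.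
  rewrite edist_subr.
  have -> : grid_point z - (grid_point u + g) = grid_point b - grid_point a.
    by rewrite gE; apply/rowP => i; rewrite !mxE; ring.
  rewrite -edist_subr; apply: le_trans (edist_triangle 0 _ _) _.
  by rewrite addrC [edist 0 _]edistC.
have : edist (grid_point z) (y + g) <= edist (grid_point z) (grid_point u + g) + edist y (grid_point u).
  apply: le_trans (edist_triangle (grid_point u + g) _ _) _.
  by rewrite edistD2r [edist (grid_point u) y]edistC.
lra.
Qed.

Definition near_grid_set (A : {set 'rV['Z_M]_n}) x :=
  exists2 z, residue z \in A & edist x (grid_point z) < 2^-1.

(** Red points at distance [1] have centers at distance less than [2], hence with equal residues,
    hence equal as the period is at least [2]. But one open ball of radius [1/2] contains no such
    pair. *)
Lemma near_grid_set_edist (A : {set 'rV['Z_M]_n}) x y : 2 <= delta * M%:R ->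
  {in A &, forall v w, w \in torus_ball v -> w = v} ->
  near_grid_set A x -> near_grid_set A y -> edist x y <> 1.
Proof.
move=> L2 indep [z zA xz] [u uA yu] xy1.
have zu : edist (grid_point (u - z)) 0 < 2.
  rewrite grid_pointB -edist_subr.
  have := edist_triangle y (grid_point u) (grid_point z).
  have := edist_triangle x y (grid_point z).
  by rewrite edistC in yu; rewrite [edist y x]edistC xy1; lra.
have /indep : residue u \in torus_ball (residue z).
  by rewrite inE; apply/asboolP; exists (u - z) => //; rewrite residueB addrC subrK.
move=> /(_ zA uA) ruz.
have [t tE] : exists t, u - z = M%:Z *: t by apply: residue_eq0; rewrite residueB ruz subrr.
have uz : u = z.
  apply/eqP; rewrite -subr_eq0; apply: contraTT zu => t0; rewrite -leNgt tE grid_pointZ.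
  have [i ti] : exists i, t 0 i != 0.
    apply/existsP; apply: contraR t0 => /existsPn h; rewrite tE; apply/eqP/rowP => i; rewrite !mxE.
    by have /negPn/eqP -> := h i; rewrite mulr0.
  apply: le_trans (coord_le_edist _ _ i); rewrite !mxE subr0.
  rewrite normrM ger0_norm ?mulr_ge0 ?(ltW delta_gt0)//; apply: (le_trans L2).
  rewrite ler_peMr ?mulr_ge0 ?(ltW delta_gt0)//.
  by rewrite -intr_norm -[1]/(1%:~R) ler_int; lia.
have := edist_triangle (grid_point z) x y; rewrite uz edistC in yu.
by rewrite xy1; lra.
Qed.

Lemma exists_grid_point x : exists z, forall i, `|x 0 i - grid_point z 0 i| <= delta / 2.
Proof.
exists (\row_i Num.floor (x 0 i / delta + 2^-1)) => i; rewrite !mxE.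
have /andP[] := floor_itv (x 0 i / delta + 2^-1); rewrite intrD.
set m := (Num.floor _)%:~R => h1 h2.
rewrite -[x 0 i](divfK (lt0r_neq0 delta_gt0)) mulrC -mulrBr normrM (gtr0_norm delta_gt0).
by rewrite ler_pM2l// ler_norml; lra.
Qed.

End Torus.

(** * Numerical bounds and finite subfamilies *)

Lemma exists_l1_ball_bounds n : (0 < n)%N -> exists q N,
  [/\ l1_ball_card_le n 3 q, l1_ball_card_le n 6 N
    & (4 * q * N * ((2 * n + 5) * (n + n * n)) <= 10 ^ (4 * n))%N].
Proof.
(* The base [c] must be at least [(1 + 1 / b) ^ b * (2 * b + 1)]: the least integers for [b = 3] and
   [b = 6] are [17] and [33]. *)
have ball b c : (0 < b)%N -> (b.+1 ^ b * (2 * b).+1 <= c * b ^ b)%N ->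
    l1_ball_card_le n b (c ^ n).
  move=> b0 bc s us sb; have := size_l1_ball_le us sb b0 => /leq_trans h.
  rewrite -(@leq_pmul2r ((b ^ b) ^ n)) ?expn_gt0 ?b0//; apply: h.
  by rewrite -expnMn; case: (posnP n) => [->//|n0]; rewrite leq_exp2r.
case: n ball => [//|[_ _|n ball _]].
  (* With [17] and [33] the product would exceed [10 ^ 4] for [n = 1]; the cube bounds [2 * 3 + 1]
     and [2 * 6 + 1] are smaller. *)
  exists 7%N, 13%N; split; last by rewrite muln1 !expnS expn0; lia.
  - by move=> s us sb; have := size_cube_le us sb.
  - by move=> s us sb; have := size_cube_le us sb.
exists (17 ^ n.+2)%N, (33 ^ n.+2)%N; split; [| |].
  - by apply: (ball 3%N 17%N isT); rewrite !expnS expn0; lia.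
  - by apply: (ball 6%N 33%N isT); rewrite !expnS expn0; lia.
(* A second factor [17 ^ n.+2] absorbs the polynomial, and [17 * 33 * 17 = 9537 <= 10 ^ 4]. *)
have poly_le : (4 * ((2 * n.+2 + 5) * (n.+2 + n.+2 * n.+2)) <= 17 ^ n.+2)%N.
  elim: n {ball} => [|n IHn]; first by rewrite !expnS expn0; lia.
  by rewrite expnS; nia.
apply: (@leq_trans ((17 * 33 * 17) ^ n.+2)); last first.
  by rewrite expnM leq_exp2r//; rewrite !expnS expn0; lia.
have mul4 a b c : (4 * a * b * c = a * b * (4 * c))%N by rewrite -!mulnA (mulnCA 4%N) (mulnCA 4%N).
by rewrite mul4 !expnMn leq_mul2l poly_le orbT.
Qed.

(** If [K] is infinite, any large enough finite subset serves. As [a >= 0] the family is nonempty,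
    and [ord0] can index a base point. *)
Lemma exists_family_of_counting (R : realType) (T : choiceType) (K : set T) (a : R) :
  0 <= a -> (a%:E < counting K)%E ->
  exists k (p : 'I_k.+1 -> T),
    [/\ a < k.+1%:R, injective p & forall i, K (p i)].
Proof.
move=> a0 aK.
have [B BK aB] : exists2 B : {fset T}, ([set` B] `<=` K)%classic & a < (#|` B|)%:R.
  have [finK|infK] := pselect (finite_set K).
    exists (fset_set K); first by rewrite fset_setK.
    by move: aK; rewrite /counting asboolT// lte_fin.
  have [B BK aB] := infinite_set_fset (Num.truncn a).+1 infK.
  by exists B => //; apply: lt_le_trans (truncnS_gt a) _; rewrite ler_nat.
case E : #|` B| aB => [|k] aB; first by rewrite ltNge a0 in aB.
have x0 : T by case: (enum_fset B) E.
exists k, (fun i => nth x0 (enum_fset B) i); split=> //.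
  move=> i j /eqP; rewrite nth_uniq ?fset_uniq -?cardfE ?E//.
  by move/eqP/val_inj.
by move=> i; apply: BK => /=; rewrite mem_nth// E.
Qed.

Lemma ln2_le1 (R : realType) : ln 2 <= 1 :> R.
Proof.
by have := @le_ln1Dx R 1; rewrite -[1 + 1]/(2 : R); apply; lra.
Qed.

Lemma poly_le_exp2 n : (0 < n)%N -> (22 * (n * n.+1) <= 2 ^ (2 * n + 4))%N.
Proof.
case: n => // m _; elim: m => [//|m IHm].
rewrite (_ : 2 * m.+2 + 4 = (2 * m.+1 + 4).+2)%N; last by lia.
by rewrite 2!expnS; move: (expn _ _) IHm => e; nia.
Qed.

(** * Choice of the parameters and of the red set *)

Section Coloring.
Variables (R : realType) (n k : nat) (p : 'I_k.+1 -> 'rV[R]_n) (r : R) (q N : nat).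
Hypotheses (n_gt0 : (0 < n)%N) (r_gt2 : 2 < r).
Hypothesis p_sep : forall x y, x != y -> 1 <= edist (p x) (p y).
Hypothesis p_diam : forall x y, edist (p x) (p y) <= r - 1.
Hypotheses (hq : l1_ball_card_le n 3 q) (hN : l1_ball_card_le n 6 N).
Hypothesis p_many :
  (4 * q * N * ((2 * n + 5) * (n + n * n)))%:R * log2 r < k.+1%:R.

Let W : R := Num.sqrt n%:R.
Let W_gt0 : 0 < W. Proof. by rewrite sqrtr_gt0 ltr0n. Qed.
Let W_ge1 : 1 <= W. Proof. by rewrite -[1]sqrtr1 ler_sqrt ?ler0n ?ler1n. Qed.
Let W_len : W <= n%:R.
Proof. by rewrite -[leRHS](sqr_sqrtr (ler0n R n)) -/W expr2 ler_peMr ?(ltW W_gt0). Qed.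

Let delta : R := 2 / (3 * W).
(** Chosen so that the code error [n.+1%:R * s] and the rounding error [delta / 2] add up to
    [1 / (2 * W)] per coordinate, hence to [1/2] in distance. *)
Let s : R := (6 * n.+1%:R * W)^-1.
(** The period must exceed the diameter bound [r - 1] by the separation [5]. *)
Let M := (Num.truncn ((r + 4) / delta)).+1.
(** This makes [C.+1%:R * s] larger than [7 / 2 * r], hence than the period, at most [r + 5], and
    than [2 * (r - 1)], because [r > 2]. *)
Let C := Num.truncn (21 * r * n.+1%:R * W).

Let delta_gt0 : 0 < delta. Proof. by rewrite divr_gt0 ?mulr_gt0. Qed.
Let delta_le1 : delta <= 1. Proof. by rewrite ler_pdivrMr ?mulr_gt0//; have := W_ge1; lra. Qed.
Let s_gt0 : 0 < s. Proof. by rewrite invr_gt0 !mulr_gt0 ?ltr0n. Qed.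

Let period_gt : r + 4 < delta * M%:R.
Proof. by rewrite mulrC -ltr_pdivrMr//; exact: truncnS_gt. Qed.

Let period_le : delta * M%:R <= r + 5.
Proof.
have h : 0 <= (r + 4) / delta by rewrite divr_ge0 ?(ltW delta_gt0)//; move: r_gt2; lra.
have /andP[+ _] := truncn_itv h; rewrite ler_pdivlMr// /M -natr1.
by have := delta_le1; lra.
Qed.

Let M_gt1 : (1 < M)%N.
Proof.
rewrite -(ltr_nat R); have := period_gt.
have : delta * M%:R <= M%:R by rewrite ler_piMl.
by move: r_gt2; lra.
Qed.

Let r_gt0 : 0 < r. Proof. by move: r_gt2; lra. Qed.

Let C_gt : 21 * r * n.+1%:R * W < C.+1%:R. Proof. exact: truncnS_gt. Qed.

Let Cs_gt : 7 / 2 * r < C.+1%:R * s.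
Proof.
rewrite ltr_pdivlMr ?mulr_gt0 ?ltr0n//; apply: le_lt_trans C_gt.
by rewrite le_eqVlt; apply/orP; left; apply/eqP; field.
Qed.

Let C_le : C.+1%:R <= r ^+ (2 * n + 5).
Proof.
have h : 0 <= 21 * r * n.+1%:R * W by rewrite !mulr_ge0 ?ler0n ?(ltW r_gt0) ?(ltW W_gt0).
have /andP[C1 _] := truncn_itv h; rewrite -/C in C1.
have r1 : 1 <= r * (n * n.+1)%:R.
  have : 1 <= (n * n.+1)%:R :> R by rewrite ler1n muln_gt0 n_gt0.
  by move: r_gt2; nra.
rewrite (addnS (2 * n) 4).
apply: (@le_trans _ _ (r * (22 * (n * n.+1))%:R)).
  rewrite -natr1 natrM.
  have : 21 * r * n.+1%:R * W <= 21 * (r * (n * n.+1)%:R).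
    rewrite natrM -!mulrA ler_pM2l// ler_pM2l//.
    by rewrite mulrC ler_pM2r ?ltr0n.
  by move: r1; lra.
rewrite exprS ler_pM2l//.
apply: (@le_trans _ _ ((2 ^ (2 * n + 4))%:R)); first by rewrite ler_nat poly_le_exp2.
by rewrite natrX lerXn2r ?nnegrE ?ler0n ?(ltW r_gt0) ?(ltW r_gt2).
Qed.

Let q_gt0 : (0 < q)%N.
Proof.
apply: (hq (s := [:: 0])) => // z; rewrite inE => /eqP ->.
by rewrite big1// => i _; rewrite mxE.
Qed.

(** The product is at most [exp (E * ln r - m / (4 * q))], whose exponent is negative by [p_many],
    since [m >= k.+1 / N] and [ln r <= log2 r]. *)
Let failure_lt1 (J m : nat) : (J <= C.+1 ^ (n + n * n))%N -> (k.+1 <= m * N)%N ->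
  J%:R * (1 - (4 * q)%:R^-1) ^+ m < 1 :> R.
Proof.
move=> JC km; set E := ((2 * n + 5) * (n + n * n))%N.
have q4 : 0 < (4 * q)%:R :> R by rewrite ltr0n muln_gt0.
have JE : J%:R <= expR (E%:R * ln r).
  apply: (@le_trans _ _ (C.+1%:R ^+ (n + n * n))); first by rewrite -natrX ler_nat.
  rewrite mulrC expRM_natr lnK ?posrE// /E exprM.
  by rewrite lerXn2r ?nnegrE ?ler0n ?exprn_ge0 ?(ltW r_gt0).
have mE : (1 - (4 * q)%:R^-1) ^+ m <= expR (- ((4 * q)%:R^-1 * m%:R)) :> R.
  rewrite -mulNr expRM_natr lerXn2r ?nnegrE ?expR_ge0 ?expR_ge1Dx//.
  by rewrite subr_ge0 invf_le1// ler1n muln_gt0.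
apply: (@le_lt_trans _ _ (expR (E%:R * ln r) * expR (- ((4 * q)%:R^-1 * m%:R)))).
  apply: ler_pM => //; rewrite exprn_ge0// subr_ge0 invf_le1// ler1n muln_gt0 //.
rewrite -expRD -[ltRHS]expR0 ltr_expR subr_lt0.
have lnr : 0 < ln r by rewrite ln_gt0//; move: r_gt2; lra.
have lnlog : ln r <= log2 r.
  have l2 : 0 < ln 2 :> R by rewrite ln_gt0// ltr1n.
  by rewrite /log2 ler_pdivlMr// ger_pMr// ln2_le1.
have N0 : 0 < N%:R :> R by rewrite ltr0n; move: km; case: (N) => //; rewrite muln0.
rewrite ltr_pdivlMl// -(ltr_pM2r N0) -[ltRHS]natrM.
apply: (@lt_le_trans _ _ (k.+1%:R)); last by rewrite ler_nat.
apply: le_lt_trans p_many; rewrite -/E.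
rewrite (_ : _ * N%:R = (4 * q * N * E)%:R * ln r); last by rewrite !natrM; ring.
by rewrite ler_wpM2l.
Qed.

Lemma exists_red_set : exists red_set : 'rV[R]_n -> Prop,
  (forall x y, red_set x -> red_set y -> edist x y <> 1) /\
  forall f, preserves_edist p f -> exists x, red_set (f x).
Proof.
have L_gt0 : 0 < delta * M%:R by apply: lt_trans period_gt; move: r_gt2; lra.
have L_lt : delta * M%:R < C.+1%:R * s.
  by apply: le_lt_trans period_le _; apply: le_lt_trans Cs_gt; move: r_gt2; lra.
have D_lt : 2 * (r - 1) < C.+1%:R * s by apply: le_lt_trans Cs_gt; move: r_gt2; lra.
have [J [code [Jcard codeP]]] := isometry_code L_gt0 s_gt0 L_lt D_lt p_diam.
have Ie_refl : reflexive (fun x y => edist (p x) (p y) < 5) by move=> x; rewrite edistxx.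
have Ie_sym : symmetric (fun x y => edist (p x) (p y) < 5) by move=> x y; rewrite edistC.
have [I [Isep Icard]] := separated_subset (e := fun x y => edist (p x) (p y) < 5) (N := N)
  Ie_refl Ie_sym (card_close_points n_gt0 hN p_sep).
rewrite card_ord in Icard.
have /choice[round roundP] := exists_grid_point delta_gt0 (n := n).
pose isom_code j := exists2 f, preserves_edist p f & code f = j.
(* One representative for each attained code; [p] is a dummy value for the others. *)
have /choice[F FP] j : exists f, isom_code j -> preserves_edist p f /\ code f = j.
  have [[f fp fj]|nj] := pselect (isom_code j); first by exists f.
  by exists p.
have round_le y : edist y (grid_point delta (round y)) <= 3^-1.
  apply: edist_le_coord => // i.
  apply: (@le_trans _ _ (delta / 2 * W)); first by rewrite ler_pM2r.
  by rewrite le_eqVlt; apply/orP; left; apply/eqP; rewrite /delta; field; rewrite gt_eqF.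
pose c j x := residue M (round (F j x)).
have disj j : `[< isom_code j >] -> {in I &, forall x y, x != y ->
    [disjoint @torus_ball R n M delta (c j x) & @torus_ball R n M delta (c j y)]}.
  move=> /asboolP/FP[Fp _] x y xI yI xy.
  apply: (disjoint_torus_ball M_gt1 delta_gt0 _ (round_le (F j x)) (round_le (F j y))) => t.
  apply: (lattice_far M_gt1 delta_gt0 t (D := r - 1)) => //; rewrite ?Fp//.
    by apply: le_trans (ltW period_gt); move: r_gt2; lra.
  by rewrite leNgt; exact: Isep.
have [A [Aind Ahit]] := exists_hitting_independent_set (R := R)
  (@torus_ball_refl R n M delta)
  (fun c => card_torus_ball delta_gt0 c n_gt0 erefl hq)
  disj (failure_lt1 Jcard Icard).
exists (near_grid_set delta A); split.
  move=> x y; apply: near_grid_set_edist => //.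
  by apply: le_trans (ltW period_gt); move: r_gt2; lra.
move=> f fp; have cf : isom_code (code f) by exists f.
have [x xI cA] := Ahit (code f) (asboolT cf).
have [Fp Fc] := FP _ cf.
have [t tP] := codeP _ _ fp Fp (esym Fc).
(* Up to the code error, [f] differs from its representative by a period vector, which leaves the
   residue of the center unchanged. *)
exists x; exists (round (F (code f) x) + M%:Z *: t).
  by rewrite residueD residueZ// addr0.
apply: edist_lt_coord => // i; rewrite -/W -ltr_pdivlMr//.
rewrite grid_pointD grid_pointZ.
have -> : f x 0 i - (grid_point delta (round (F (code f) x))
      + (delta * M%:R) *: map_mx intr t) 0 i
    = (f x 0 i - F (code f) x 0 i - delta * M%:R * (t 0 i)%:~R)
      + (F (code f) x 0 i - grid_point delta (round (F (code f) x)) 0 i).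
  by rewrite !mxE; ring.
apply: le_lt_trans (ler_normD _ _) _.
apply: (@lt_le_trans _ _ (n.+1%:R * s + delta / 2)); first by rewrite ltr_leD.
rewrite le_eqVlt; apply/orP; left; apply/eqP; rewrite /s /delta; field.
by rewrite gt_eqF//= -natr1 gt_eqF// ltr_wpDl.
Qed.

End Coloring.

Local Open Scope classical_set_scope.

Theorem theorem1p1 (R : realType) (n : nat) (r : R) (K : set 'rV[R]_n)
    (n_ge1 : (1 <= n)%N) (r_gt2 : 2 < r)
    (K_sep : t_separated 1 K)
    (K_diam : (diameter K <= (r - 1)%:E)%E)
    (K_card : ((10 ^+ (4 * n) * log2 r)%:E < counting K)%E) :
  ~ arrows n (ell R 2) K.
Proof.
have log_gt0 : 0 < log2 r by rewrite divr_gt0 ?ln_gt0//; lra.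
have bound_ge0 : 0 <= 10 ^+ (4 * n) * log2 r by rewrite mulr_ge0 ?exprn_ge0// ltW.
have [k [p [pk pinj pK]]] := exists_family_of_counting bound_ge0 K_card.
have p_sep x y : x != y -> 1 <= edist (p x) (p y).
  by move=> xy; apply: K_sep => // /pinj /eqP; apply/negP.
have p_diam x y : edist (p x) (p y) <= r - 1.
  rewrite -lee_fin; apply: le_trans K_diam; apply: ereal_sup_ubound.
  by exists (p x, p y) => //; split; exact: pK.
have [q [N [hq hN bound]]] := exists_l1_ball_bounds n_ge1.
have p_many : (4 * q * N * ((2 * n + 5) * (n + n * n)))%:R * log2 r < k.+1%:R.
  by apply: le_lt_trans pk; rewrite ler_pM2r// -natrX ler_nat.
have [red_set [red_edist red_hit]] := exists_red_set n_ge1 r_gt2 p_sep p_diam hq hN p_many.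
apply/not_arrows_ell2P; exists (fun x => if `[< red_set x >] then red else blue); split.
  move=> x y; case: asboolP => // redx _; case: asboolP => // redy _; exact: red_edist.
(* [f] is isometric only on [K], which suffices because [p] takes its values there. *)
move=> S [f [f_edist <-]]; have [|x redx] := red_hit (f \o p).
  by move=> x y; exact: f_edist.
by exists (f (p x)); [exists (p x)|rewrite asboolT].
Qed.
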